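(* Let $n\ge2$. For $k=1$ and for $k=-1$, the group $B^{(k)}(\infty,\infty,n)$ is isomorphic to the group $B(\infty,\infty,n)$.
   Context: For $k\in\mathbb{Z}\setminus\{0\}$, $B^{\oplus k}(\infty,\infty,n)$ is the monoid presented by generators $\tilde t_i$ ($i\in\mathbb{Z}$), $\tilde s_3,\dots,\tilde s_n$ and relations: $\tilde s_i\tilde s_j\tilde s_i=\tilde s_j\tilde s_i\tilde s_j$ for $|i-j|=1$; $\tilde s_i\tilde s_j=\tilde s_j\tilde s_i$ for $|i-j|>1$; $\tilde s_3\tilde t_i\tilde s_3=\tilde t_i\tilde s_3\tilde t_i$ for $i\in\mathbb{Z}$; $\tilde s_j\tilde t_i=\tilde t_i\tilde s_j$ for $i\in\mathbb{Z}$ and $4\le j\le n$; $\tilde t_i\tilde t_{i-k}=\tilde t_j\tilde t_{j-k}$ for $i,j\in\mathbb{Z}$. This is a Garside monoid (in particular cancellative with common multiples), and $B^{(k)}(\infty,\infty,n)$ denotes its group of fractions, i.e. the group given by the same presentation. $B(\infty,\infty,n)$ is the group presented by generators $\tilde t_0,\tilde t_1,\tilde s_3,\dots,\tilde s_n$ and relations: $\tilde s_i\tilde s_{i+1}\tilde s_i=\tilde s_{i+1}\tilde s_i\tilde s_{i+1}$ for $3\le i\le n-1$; $\tilde s_i\tilde s_j=\tilde s_j\tilde s_i$ for $|i-j|>1$; $\tilde s_3\tilde t_i\tilde s_3=\tilde t_i\tilde s_3\tilde t_i$ for $i=0,1$; $\tilde s_j\tilde t_i=\tilde t_i\tilde s_j$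 for $i=0,1$ and $4\le j\le n$; $\tilde s_3\tilde t_1\tilde t_0\tilde s_3\tilde t_1\tilde t_0=\tilde t_1\tilde t_0\tilde s_3\tilde t_1\tilde t_0\tilde s_3$ (if $n=2$ there are no relations). By a result of Shi, $B(\infty,\infty,n)$ is isomorphic to the affine Artin group of type $\tilde A_{n-1}$. *)

(* Defs.v *)
From HB Require Import structures.
From mathcomp Require Import all_boot all_order all_algebra.
From mathcomp Require Import boolp.

Set Implicit Arguments.
Unset Strict Implicit.
Unset Printing Implicit Defensive.

Local Open Scope quotient_scope.

(* MathComp's [Grp] presentations only describe finite groups, hence this
   construction. A relation is a pair of positive words, so that [R] also reads
   as a monoid presentation; a letter (true, x) stands for x and (false, x) for
   x^-1. *)
Section PresentedGroup.
Variables (X : choiceType) (R : seq X -> seq X -> Prop).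

Definition pos_word (u : seq X) : seq (bool * X) := [seq (true, x) | x <- u].

Inductive pres_eq : seq (bool * X) -> seq (bool * X) -> Prop :=
| PresRefl u : pres_eq u u
| PresSym u v : pres_eq u v -> pres_eq v u
| PresTrans u v w : pres_eq u v -> pres_eq v w -> pres_eq u w
| PresCat u u' v v' :
    pres_eq u u' -> pres_eq v v' -> pres_eq (u ++ v) (u' ++ v')
| PresCancel b x : pres_eq [:: (b, x); (~~ b, x)] [::]
| PresRel u v : R u v -> pres_eq (pos_word u) (pos_word v).

Definition pres_rel (u v : seq (bool * X)) : bool := `[< pres_eq u v >].

Lemma pres_rel_refl : reflexive pres_rel.
Proof. by move=> u; apply/asboolP; apply: PresRefl. Qed.

Lemma pres_rel_sym : symmetric pres_rel.
Proof. by move=> u v; apply/asboolP/asboolP => /PresSym. Qed.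

Lemma pres_rel_trans : transitive pres_rel.
Proof.
by move=> v u w /asboolP uv /asboolP vw; apply/asboolP; apply: PresTrans vw.
Qed.

Canonical pres_equiv :=
  EquivRel pres_rel pres_rel_refl pres_rel_sym pres_rel_trans.

Definition inv_word (u : seq (bool * X)) : seq (bool * X) :=
  rev [seq (~~ a.1, a.2) | a <- u].

Lemma inv_word_cat u v : inv_word (u ++ v) = inv_word v ++ inv_word u.
Proof. by rewrite /inv_word map_cat rev_cat. Qed.

Lemma pres_mulV u : pres_eq (u ++ inv_word u) [::].
Proof.
elim: u => [|[b x] u IHu]; first exact: PresRefl.
have -> : ((b, x) :: u) ++ inv_word ((b, x) :: u) =
    [:: (b, x)] ++ ((u ++ inv_word u) ++ [:: (~~ b, x)]).
  by rewrite -[in inv_word _]cat1s inv_word_cat !catA.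
apply: PresTrans (PresCancel b x).
apply: (PresCat (PresRefl _)).
exact: (PresCat IHu (PresRefl _)).
Qed.

Lemma inv_wordK : involutive inv_word.
Proof.
move=> u; rewrite /inv_word map_rev revK -map_comp -[RHS]map_id.
by apply: eq_map => -[[] x].
Qed.

Lemma pres_Vmul u : pres_eq (inv_word u ++ u) [::].
Proof. by rewrite -{2}[u]inv_wordK; apply: pres_mulV. Qed.

Lemma pres_inv u v : pres_eq u v -> pres_eq (inv_word u) (inv_word v).
Proof.
move=> uv; apply: (@PresTrans _ (inv_word u ++ (v ++ inv_word v))).
  rewrite -{1}[inv_word u]cats0; apply: PresCat (PresRefl _) _.
  exact/PresSym/pres_mulV.
rewrite catA -[X in pres_eq _ X]cat0s; apply: PresCat (PresRefl _).
apply: PresTrans (pres_Vmul u); apply: PresCat (PresRefl _) _.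
exact: PresSym.
Qed.

Definition presented_group : Type := {eq_quot pres_equiv}.
HB.instance Definition _ := Choice.on presented_group.
HB.instance Definition _ := EqQuotient.on presented_group.

Lemma pres_piP u v : \pi_presented_group u = \pi_presented_group v <-> pres_eq u v.
Proof. by split=> [/eqmodP/asboolP | uv] //; apply/eqmodP/asboolP. Qed.

Definition pres_one : presented_group := \pi_presented_group [::].
Definition pres_mul (x y : presented_group) : presented_group :=
  \pi_presented_group (repr x ++ repr y).
Definition pres_invg (x : presented_group) : presented_group :=
  \pi_presented_group (inv_word (repr x)).

Lemma pres_repr_pi u : pres_eq (repr (\pi_presented_group u)) u.
Proof. by apply/pres_piP; rewrite reprK. Qed.

Lemma pres_mulE u v :
  pres_mul (\pi_presented_group u) (\pi_presented_group v) = \pi_presented_group (u ++ v).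
Proof. by apply/pres_piP; apply: PresCat; apply: pres_repr_pi. Qed.

Lemma pres_invE u :
  pres_invg (\pi_presented_group u) = \pi_presented_group (inv_word u).
Proof. by apply/pres_piP/pres_inv/pres_repr_pi. Qed.

Lemma pres_mulA : associative pres_mul.
Proof.
by move=> x y z; elim/quotW: x => u; elim/quotW: y => v; elim/quotW: z => w;
  rewrite (pres_mulE v w) (pres_mulE u v) !pres_mulE catA.
Qed.

Lemma pres_mul1g : left_id pres_one pres_mul.
Proof. by move=> x; elim/quotW: x => u; rewrite pres_mulE. Qed.

Lemma pres_mulg1 : right_id pres_one pres_mul.
Proof. by move=> x; elim/quotW: x => u; rewrite pres_mulE cats0. Qed.

Lemma pres_mulVg : left_inverse pres_one pres_invg pres_mul.
Proof.
by move=> x; elim/quotW: x => u; rewrite pres_invE pres_mulE; apply/pres_piP/pres_Vmul.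
Qed.

Lemma pres_mulgV : right_inverse pres_one pres_invg pres_mul.
Proof.
by move=> x; elim/quotW: x => u; rewrite pres_invE pres_mulE; apply/pres_piP/pres_mulV.
Qed.

HB.instance Definition _ := isGroup.Build presented_group
  pres_mulA pres_mul1g pres_mulg1 pres_mulVg pres_mulgV.

End PresentedGroup.

Arguments presented_group {X} R.

Definition isomorphic_groups (G H : groupType) : Prop :=
  exists f : {multiplicative G -> H}, bijective f.

Import Order.TTheory GRing.Theory Num.Theory.
Local Open Scope ring_scope.

Definition s_index (n : nat) := {j : nat | (3 <= j <= n)%N}.

Section Presentations.
Variables (I : Type) (n : nat).
Definition t_ (i : I) : I + s_index n := inl i.
Definition s_ (j : s_index n) : I + s_index n := inr j.
End Presentations.
Arguments t_ {I n} i.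
Arguments s_ {I n} j.

Inductive Bk_rel (k : int) (n : nat) :
    seq (int + s_index n) -> seq (int + s_index n) -> Prop :=
| Bk_braid_ss (i j : s_index n) : `|(val i)%:Z - (val j)%:Z| = 1 ->
    Bk_rel k [:: s_ i; s_ j; s_ i] [:: s_ j; s_ i; s_ j]
| Bk_comm_ss (i j : s_index n) : 1 < `|(val i)%:Z - (val j)%:Z| ->
    Bk_rel k [:: s_ i; s_ j] [:: s_ j; s_ i]
| Bk_braid_s3t (j : s_index n) (i : int) : val j = 3%N ->
    Bk_rel k [:: s_ j; t_ i; s_ j] [:: t_ i; s_ j; t_ i]
| Bk_comm_st (j : s_index n) (i : int) : (4 <= val j)%N ->
    Bk_rel k [:: s_ j; t_ i] [:: t_ i; s_ j]
| Bk_tt (i j : int) :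
    Bk_rel k [:: t_ i; t_ (i - k)] [:: t_ j; t_ (j - k)].

(* B^(k)(oo,oo,n), the group of fractions of the monoid B^{(+)k}(oo,oo,n), taken as
   the group with the same presentation. *)
Definition Bk_oo (k : int) (n : nat) : groupType :=
  presented_group (@Bk_rel k n).

Inductive B_rel (n : nat) :
    seq ('I_2 + s_index n) -> seq ('I_2 + s_index n) -> Prop :=
| B_braid_ss (i j : s_index n) : val j = (val i).+1 ->
    B_rel [:: s_ i; s_ j; s_ i] [:: s_ j; s_ i; s_ j]
| B_comm_ss (i j : s_index n) : 1 < `|(val i)%:Z - (val j)%:Z| ->
    B_rel [:: s_ i; s_ j] [:: s_ j; s_ i]
| B_braid_s3t (j : s_index n) (i : 'I_2) : val j = 3%N ->
    B_rel [:: s_ j; t_ i; s_ j] [:: t_ i; s_ j; t_ i]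
| B_comm_st (j : s_index n) (i : 'I_2) : (4 <= val j)%N ->
    B_rel [:: s_ j; t_ i] [:: t_ i; s_ j]
| B_s3tt (j : s_index n) : val j = 3%N ->
    B_rel [:: s_ j; t_ 1; t_ 0; s_ j; t_ 1; t_ 0]
          [:: t_ 1; t_ 0; s_ j; t_ 1; t_ 0; s_ j].

(* B(oo,oo,n) *)
Definition B_oo (n : nat) : groupType := presented_group (@B_rel n).

(* Main.v *)
Require Import Defs.
From HB Require Import structures.
From mathcomp Require Import all_boot all_order all_algebra.
From mathcomp Require Import zify.

(** Write [d = t_1 t_0] in [B_oo n]. In [Bk_oo 1 n] the relations
    [t_i t_(i-1) = t_j t_(j-1)] say that [t_(i+1) t_i] is a constant [d], so
    that [t_0] and [t_1] determine every [t_i], through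
    [t_(i+1) = d t_i^-1] and [t_(i-1) = t_i^-1 d] ([zigzag]). Eliminating the
    other [t_i] uses up these relations, leaving none between [t_0] and [t_1]
    alone, as in [B_oo n]. What has to be compared is the relations involving
    some [s_j].

    An [s_j] commuting with [t_0] and [t_1] commutes with [d], hence with every
    [t_i]. For [s = s_3], the heart of the matter is [braided_third]: if
    [z y = y x = d] and [s] satisfies the braid relation with [x] and [y], then
    it satisfies the braid relation with [z] if and only if
    [s d s d = d s d s]. Applied to [t_0, t_1, t_2] it derives the last relation
    of [B_oo n] from the braid relations of [Bk_oo 1 n]; conversely, since [d]
    is the same for all consecutive pairs, it propagates the braid relation from
    [t_0] and [t_1] to all the [t_i] ([braided_zigzag]).

    Finally, the substitution of [t_(-i)] for [t_i] exchanges the presentations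
    for [k = 1] and [k = -1]; both cases are treated at once by matching [t_i]
    in [Bk_oo k n] with the term of index [k i] of the zigzag, which uses only
    [k * k = 1]. *)

Set Implicit Arguments.
Unset Strict Implicit.
Unset Printing Implicit Defensive.

Import GRing.Theory.

(** * Homomorphisms from a presented group *)

Local Open Scope group_scope.

Lemma morph_group1 (G H : groupType) (f : G -> H) :
  {morph f : x y / x * y} -> f 1 = 1.
Proof. by move=> fM; apply: (mulgI (f 1)); rewrite -fM !mulg1. Qed.

Lemma morph_groupV (G H : groupType) (f : G -> H) :
  {morph f : x y / x * y} -> {morph f : x / x^-1}.
Proof.
by move=> fM x; apply: (mulgI (f x)); rewrite -fM !mulgV morph_group1.
Qed.

Section PresentedGroupHom.
Variables (X : choiceType) (R : seq X -> seq X -> Prop).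

Definition pres_gen (x : X) : presented_group R :=
  (\pi_(presented_group R) [:: (true, x)])%qT.

Definition respects (G : groupType) (phi : X -> G) : Prop :=
  forall u v, R u v -> \prod_(x <- u) phi x = \prod_(x <- v) phi x.

Lemma pi_nil : (\pi_(presented_group R) [::])%qT = 1 :> presented_group R.
Proof. by []. Qed.

Lemma pi_cat u v :
  (\pi_(presented_group R) (u ++ v))%qT =
  (\pi_(presented_group R) u)%qT * (\pi_(presented_group R) v)%qT
    :> presented_group R.
Proof. by apply/esym; exact: pres_mulE. Qed.

Lemma pi_pos_word u :
  (\pi_(presented_group R) (pos_word u))%qT = \prod_(x <- u) pres_gen x.
Proof.
elim: u => [|x u IHu]; first by rewrite big_nil.
by rewrite big_cons -IHu; exact: (pi_cat [:: (true, x)]).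
Qed.

Lemma pres_gen_respects : respects pres_gen.
Proof.
by move=> u v uv; rewrite -!pi_pos_word; apply/pres_piP; apply: PresRel.
Qed.

Lemma pi_inv_letter x :
  (\pi_(presented_group R) [:: (false, x)])%qT = (pres_gen x)^-1.
Proof. by rewrite [RHS](pres_invE R [:: (true, x)]). Qed.

Lemma pres_hom_ext (G : groupType) (f g : presented_group R -> G) :
  {morph f : x y / x * y} -> {morph g : x y / x * y} ->
  (forall x, f (pres_gen x) = g (pres_gen x)) -> f =1 g.
Proof.
move=> fM gM fg x; elim/quotW: x => u.
elim: u => [|[b x] u IHu]; first by rewrite pi_nil !morph_group1.
rewrite -[_ :: u]cat1s pi_cat fM gM IHu; congr (_ * _).
by case: b; rewrite ?pi_inv_letter ?morph_groupV // fg.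
Qed.

(** The universal property of the presentation: evaluate a word by [phi]; the
    value is constant on each class, so it can be read on representatives. *)
Lemma pres_hom_exists (G : groupType) (phi : X -> G) :
  respects phi ->
  exists2 f : presented_group R -> G,
    {morph f : x y / x * y} & forall x, f (pres_gen x) = phi x.
Proof.
move=> phiR.
pose letter (a : bool * X) := if a.1 then phi a.2 else (phi a.2)^-1.
pose value (w : seq (bool * X)) := \prod_(a <- w) letter a.
have value_eq u v : pres_eq R u v -> value u = value v.
  elim=> {u v} //.
  - by move=> u v w _ -> _ ->.
  - move=> u u' v v' _ uu' _ vv'.
    by rewrite /value !big_cat -/(value u) uu' -/(value v) vv'.
  - by move=> [] x; rewrite /value big_cons big_seq1 big_nil /letter /= ?mulgV ?mulVg.
  - by move=> u v /phiR; rewrite /value !big_map.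
pose F (x : presented_group R) := value (repr x).
have F_pi u : F (\pi_(presented_group R) u)%qT = value u.
  exact/value_eq/pres_repr_pi.
have FM : {morph F : x y / x * y}.
  move=> x y; elim/quotW: x => u; elim/quotW: y => v.
  by rewrite [_ * _]pres_mulE !F_pi /value big_cat.
by exists F => // x; rewrite F_pi /value big_seq1.
Qed.

End PresentedGroupHom.

Lemma presented_group_iso (X Y : choiceType) (R : seq X -> seq X -> Prop)
    (S : seq Y -> seq Y -> Prop)
    (f : presented_group R -> presented_group S)
    (g : presented_group S -> presented_group R) :
  {morph f : x y / x * y} -> {morph g : x y / x * y} ->
  (forall x, g (f (pres_gen R x)) = pres_gen R x) ->
  (forall y, f (g (pres_gen S y)) = pres_gen S y) ->
  isomorphic_groups (presented_group R) (presented_group S).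
Proof.
move=> fM gM gf fg.
pose hom := HB.pack_for {multiplicative presented_group R -> presented_group S} f
  (isMultiplicative.Build (presented_group R) (presented_group S) f fM).
exists hom; exists g.
  by apply: (@pres_hom_ext _ _ _ (g \o f) id) => // x y /=; rewrite fM gM.
by apply: (@pres_hom_ext _ _ _ (f \o g) id) => // x y /=; rewrite gM fM.
Qed.

(** * Braid relations and zigzags *)

Section Braided.
Variable G : groupType.
Implicit Types (a b d s x y z : G) (u : int -> G).

Definition braided x y := x * y * x = y * x * y.

Lemma braided_sym x y : braided x y -> braided y x.
Proof. by move=> xy; apply/esym. Qed.

Lemma braidedV x y : braided x y -> braided x^-1 y^-1.
Proof. by rewrite /braided -!invgM !mulgA => ->. Qed.

Lemma braidedVK x y : braided x^-1 y^-1 -> braided x y.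
Proof. by move/braidedV; rewrite !invgK. Qed.

Lemma braided_conj x y : braided x y -> x^-1 * y * x = y * x * y^-1.
Proof.
move=> xy; apply: (mulgI x); apply: (mulIg y).
by rewrite !mulgA mulgV mul1g mulgVK.
Qed.

(** With [z = y x y^-1], right multiplication by [y s x] turns the two sides of
    the braid relation between [s] and [z] into those of [s d s d = d s d s]. *)
Lemma braided_third s x y z d :
  z * y = d -> y * x = d -> braided s x -> braided s y ->
  braided s z <-> s * d * s * d = d * s * d * s.
Proof.
move=> zy yx sx sy; have -> : z = y * x * y^-1 by rewrite yx -zy mulgK.
have sJ := braided_conj (braided_sym sy).
have -> : s * d * s * d = s * (y * x * y^-1) * s * (y * s * x).
  transitivity (s * y * x * (y^-1 * s * y) * s * x); last by rewrite !mulgA.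
  by rewrite sJ -yx !mulgA mulgVK.
have -> : d * s * d * s = y * x * y^-1 * s * (y * x * y^-1) * (y * s * x).
  transitivity (y * x * (y^-1 * s * y) * x * s * x); last by rewrite !mulgA mulgVK.
  transitivity (y * x * s * y * (s^-1 * (x * s * x))); last by rewrite sJ !mulgA.
  by rewrite -sx -yx !mulgA mulgVK.
by split=> [-> | /mulIg].
Qed.

(** Inverting all the letters reverses the order of [x], [y], [z] and replaces [d]
    by [d^-1], so that [braided_third] can also be used downwards. *)
Lemma braided_first s x y z d :
  z * y = d -> y * x = d -> braided s y -> braided s z ->
  s * d * s * d = d * s * d * s -> braided s x.
Proof.
move=> zy yx sy sz sd; apply: braidedVK.
apply/(@braided_third _ z^-1 y^-1 _ d^-1); try exact: braidedV.
- by rewrite -invgM yx.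
- by rewrite -invgM zy.
- by rewrite -!invgM !mulgA sd.
Qed.

Lemma oppzS m : (- m%:Z = - m.+1%:Z + 1)%R.
Proof. by rewrite -addn1 PoszD opprD subrK. Qed.

(** The family [u] indexed by the integers, determined by [u 0 = a] and
    [u (i + 1) * u i = d]: the elements [t_i] as functions of [d] and [t_0]. *)
Definition zigzag d a (i : int) : G :=
  match i with
  | Posz m => iter m (fun x => d * x^-1) a
  | Negz m => iter m.+1 (fun x => x^-1 * d) a
  end.

Lemma zigzagS d a i : zigzag d a (i + 1)%R * zigzag d a i = d.
Proof.
case: i => [m|[|m]].
- by rewrite -PoszD addn1 /= mulgVK.
- by rewrite (_ : (_ + 1)%R = 0%R) //= mulVKg.
- by rewrite !NegzE -oppzS -NegzE /= mulVKg.
Qed.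

Lemma zigzag1 d a : zigzag d a 1%R = d * a^-1.
Proof. by []. Qed.

Lemma zigzag_unique d u :
  (forall i, u (i + 1)%R * u i = d) -> u =1 zigzag d (u 0%R).
Proof.
move=> ud; elim/int_rect => // m IHm.
  apply: (mulIg (u m)); rewrite -addn1 PoszD ud.
  by rewrite IHm zigzagS.
apply: (mulgI (u (- m%:Z)%R)).
by rewrite {1}oppzS ud IHm oppzS zigzagS.
Qed.

Lemma commute_zigzag s d a i : commute s a -> commute s d -> commute s (zigzag d a i).
Proof.
move=> sa sd; case: i => m; rewrite /zigzag; last move: m.+1 => {}m.
  by elim: m => //= m IHm; apply: commuteM => //; apply: commuteV.
by elim: m => //= m IHm; apply: commuteM => //; apply: commuteV.
Qed.

Lemma braided_zigzag s a b i :
  braided s a -> braided s b ->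
  s * (b * a) * s * (b * a) = b * a * s * (b * a) * s ->
  braided s (zigzag (b * a) a i).
Proof.
move=> sa sb sd; set u := zigzag _ _.
(* The induction needs two consecutive terms to reach a third on either side. *)
suff: braided s (u i) /\ braided s (u (i + 1)%R) by case.
have uS := zigzagS (b * a) a : forall i, u (i + 1)%R * u i = b * a.
elim/int_rect: i => [|m [sm sm1]|m [sm sm1]].
- by rewrite add0r /u zigzag1 mulgK.
- rewrite -addn1 PoszD; split=> //.
  by apply/(braided_third (uS _) (uS m) sm sm1).
- rewrite -oppzS; split=> //; apply: braided_first (uS _) _ sm sm1 sd.
  by rewrite {1}oppzS uS.
Qed.

End Braided.

(** * The isomorphism *)

Local Open Scope ring_scope.

Section Isomorphism.
Variables (n : nat) (k : int).

Local Notation genB := (pres_gen (@B_rel n)).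
Local Notation genBk := (pres_gen (@Bk_rel k n)).
Local Notation tBk i := (genBk (t_ i%R)).
Local Notation tB i := (zigzag (genB (t_ 1%R) * genB (t_ 0%R))%g (genB (t_ 0)) i%R).

(** The index [k * i] converts the step [k] in the relations of [Bk_oo k n] into
    the step [k * k = 1] of the zigzag. *)
Definition Bk_to_B (x : int + s_index n) : presented_group (@B_rel n) :=
  match x with
  | inl i => tB (k * i)
  | inr j => genB (s_ j)
  end.

Definition B_to_Bk (x : 'I_2 + s_index n) : presented_group (@Bk_rel k n) :=
  match x with
  | inl i => tBk (k * (i : nat)%:Z)
  | inr j => genBk (s_ j)
  end.

Lemma Bk_to_B_respects : k * k = 1 -> respects (@Bk_rel k n) Bk_to_B.
Proof.
move=> kk u v uv; have gen_rel := @pres_gen_respects _ (@B_rel n).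
case: uv => [i j ij|i j ij|j i j3|j i j4|i j]; rewrite !big_cons !big_nil !mulg1 /=.
- have braidS (i' j' : s_index n) : val j' = (val i').+1 ->
      braided (genB (s_ i')) (genB (s_ j')).
    by move=> /B_braid_ss /gen_rel; rewrite !big_cons !big_nil !mulg1 !mulgA.
  rewrite !mulgA; have [/braidS//|/braidS/braided_sym//] :
    val j = (val i).+1 \/ val i = (val j).+1 by lia.
- by have /gen_rel := B_comm_ss ij; rewrite !big_cons !big_nil !mulg1.
- have braid_t l : braided (genB (s_ j)) (genB (t_ l)).
    by have /gen_rel := B_braid_s3t l j3; rewrite !big_cons !big_nil !mulg1 !mulgA.
  rewrite !mulgA; apply: braided_zigzag => //.
  by have /gen_rel := B_s3tt j3; rewrite !big_cons !big_nil !mulg1 !mulgA.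
- have comm_t l : commute (genB (s_ j)) (genB (t_ l)).
    by have /gen_rel := B_comm_st l j4; rewrite !big_cons !big_nil !mulg1.
  by apply: commute_zigzag => //; apply: commuteM.
- have tB_tB l : (tB (k * l) * tB (k * (l - k)) = genB (t_ 1%R) * genB (t_ 0%R))%g.
    by rewrite mulrBr kk -{1}[k * l](subrK 1) zigzagS.
  by rewrite !tB_tB.
Qed.

(** The relations between the [t_i] alone, put in the form to which
    [zigzag_unique] applies: the step [k] of the indices becomes a step [1] of
    [i], whatever the sign of [k]. *)
Lemma genBk_tS (i : int) :
  (tBk (k * (i + 1)) * tBk (k * i) = tBk k * tBk 0)%g.
Proof.
have := pres_gen_respects (Bk_tt k n (k * (i + 1)) k).
by rewrite !big_cons !big_nil !mulg1 subrr mulrDr mulr1 addrK.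
Qed.

Lemma B_to_Bk_respects : respects (@B_rel n) B_to_Bk.
Proof.
move=> u v uv; have gen_rel := @pres_gen_respects _ (@Bk_rel k n).
have braid_t (j : s_index n) i : val j = 3%N -> braided (genBk (s_ j)) (tBk i).
  by move=> /Bk_braid_s3t-/(_ k i)/gen_rel; rewrite !big_cons !big_nil !mulg1 !mulgA.
case: uv => [i j ij|i j ij|j i j3|j i j4|j j3]; rewrite !big_cons !big_nil !mulg1 /=.
- have /(@Bk_braid_ss k)/gen_rel : `|(val i)%:Z - (val j)%:Z| = 1 by lia.
  by rewrite !big_cons !big_nil !mulg1.
- by have /gen_rel := Bk_comm_ss k ij; rewrite !big_cons !big_nil !mulg1.
- by rewrite !mulgA; apply: braid_t.
- have /gen_rel := Bk_comm_st k (k * (i : nat)%:Z) j4.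
  by rewrite !big_cons !big_nil !mulg1.
- (* The three consecutive elements are [t_(2 k)], [t_k] and [t_0]. *)
  have := braided_third (genBk_tS 1) (genBk_tS 0) (braid_t j _ j3) (braid_t j _ j3).
  rewrite -(genBk_tS 0) !mulgA => /iffLR; apply; exact: braid_t.
Qed.

Lemma Bk_oo_iso_B_oo : k * k = 1 -> isomorphic_groups (Bk_oo k n) (B_oo n).
Proof.
move=> kk.
have [f fM f_gen] := pres_hom_exists (Bk_to_B_respects kk).
have [g gM g_gen] := pres_hom_exists B_to_Bk_respects.
apply: (presented_group_iso fM gM); case=> [i|j];
  rewrite ?f_gen ?g_gen /= ?f_gen ?g_gen //=.
- (* The images under [g] of the terms of the zigzag, and the [t_(k l)], are two
     families with the same term at [0] and the same product [t_k t_0]. *)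
  have gt (l : 'I_2) : g (genB (t_ l)) = tBk (k * (l : nat)%:Z).
    by rewrite g_gen.
  have gtBS l : (g (tB (l + 1)) * g (tB l) = tBk k * tBk 0)%g.
    by rewrite -gM zigzagS gM !gt mulr0 mulr1.
  have -> : tBk i = tBk (k * (k * i)) by rewrite mulrA kk mul1r.
  rewrite (zigzag_unique gtBS).
  rewrite (zigzag_unique (u := fun l => tBk (k * l)) genBk_tS).
  by rewrite [tB 0]/(genB (t_ 0)) gt.
- rewrite mulrA kk mul1r; case: i => [[|[|//]] i2] /=.
    by rewrite (_ : Ordinal i2 = 0) //; apply: val_inj.
  by rewrite mulgK (_ : Ordinal i2 = 1) //; apply: val_inj.
Qed.

End Isomorphism.

Theorem corollary5p4 (n : nat) (hn : (2 <= n)%N) (k : int) (hk : k = 1 \/ k = -1) :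
  isomorphic_groups (Bk_oo k n) (B_oo n).
Proof. by apply: Bk_oo_iso_B_oo; case: hk => ->. Qed.
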